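(* Let $0\le d\le l$ be integers. For any $P(\delta_0,\delta_1)\in\mathbb{C}[\delta_0,\delta_1]_l$ and any $Q\in\mathbb{C}[X_0,X_1]_d$ one has, via the isomorphisms $D_l$ and $D_{l-d}$, $${}^{\mathrm t}m_Q(P(\delta_0,\delta_1))=Q\left(\frac{\partial}{\partial\delta_0},\frac{\partial}{\partial\delta_1}\right)(P(\delta_0,\delta_1)),$$ that is, $${}^{\mathrm t}m_Q\big(D_l(P(\delta_0,\delta_1))\big)=D_{l-d}\left(Q\left(\frac{\partial}{\partial\delta_0},\frac{\partial}{\partial\delta_1}\right)(P(\delta_0,\delta_1))\right)\quad\text{in }\mathbb{C}[X_0,X_1]_{l-d}^*.$$ In other words, putting $\Phi:=D_l(P(\delta_0,\delta_1))\in\mathbb{C}[X_0,X_1]_l^*$, the differential operator associated with ${}^{\mathrm t}m_Q(\Phi)$ via $D_{l-d}^{-1}$ is obtained by applying the differential operator $Q(\frac{\partial}{\partial\delta_0},\frac{\partial}{\partial\delta_1})$ to $P(\delta_0,\delta_1)$, regarded as a polynomial in the abstract variables $\delta_0,\delta_1$.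
   Context: $\mathbb{C}[X_0,X_1]_l$ is the complex vector space of homogeneous polynomials of degree $l$ in $X_0,X_1$, and $^*$ denotes the dual space. Put $\delta_i:=\frac{\partial}{\partial X_i}$ and let $\mathbb{C}[\delta_0,\delta_1]_l=\{P(\delta_0,\delta_1)\mid P\in\mathbb{C}[X_0,X_1]_l\}$ be the space of constant-coefficient homogeneous differential operators of order $l$. The linear isomorphism $D_l:\mathbb{C}[\delta_0,\delta_1]_l\to\mathbb{C}[X_0,X_1]_l^*$ assigns to $\Delta$ the linear form $R\mapsto\Delta(R)$ (the constant obtained by applying the differential operator $\Delta$ to $R\in\mathbb{C}[X_0,X_1]_l$). For $Q\in\mathbb{C}[X_0,X_1]_d$, $m_Q:\mathbb{C}[X_0,X_1]_{l-d}\to\mathbb{C}[X_0,X_1]_l$ is multiplication by $Q$ and ${}^{\mathrm t}m_Q:\mathbb{C}[X_0,X_1]_l^*\to\mathbb{C}[X_0,X_1]_{l-d}^*$ is its transpose. *)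

(* Defs.v *)
From HB Require Import structures.
From mathcomp Require Import all_boot all_order all_algebra.
From mathcomp Require Import boolp functions reals.
From mathcomp Require Import complex.
From mathcomp Require Import ssrcomplements mpoly.

Set Implicit Arguments.
Unset Strict Implicit.
Unset Printing Implicit Defensive.

Import GRing.Theory Num.Theory.

Local Open Scope ring_scope.

(* The complex numbers are R[i], for R : realType. *)

Notation bipoly R := {mpoly R[i][2]}.
Notation hpoly R l := (dhomog 2 R[i] l).

Definition dual (K : fieldType) (V : vectType K) : vectType K := 'Hom(V, K^o).

Lemma dim_dual (K : fieldType) (V : vectType K) : dim (dual V) = dim V.
Proof. exact: muln1. Qed.

Definition transpose (K : fieldType) (V W : vectType K) (f : 'Hom(V, W))
  (phi : dual W) : dual V := (phi \o f)%VF.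

(* P(d/dX_0, d/dX_1), acting on all polynomials; 'X_[m] is replaced by the
   iterated partial derivative of multi-order m. *)
Definition diffop (R : realType) (P F : bipoly R) : bipoly R :=
  \sum_(m <- msupp P) P@_m *: F^`M[m].

Section DiffOp.
Variable R : realType.
Implicit Types (P Q F : bipoly R) (m : 'X_{1..2}) (l d : nat).

Lemma diffopE P F (k : nat) : (msize P <= k)%N ->
  diffop P F = \sum_(m : 'X_{1..2 < k}) P@_m *: F^`M[m].
Proof.
move=> le_Pk; rewrite /diffop (big_mksub 'X_{1..2 < k}) //=; first last.
- by move=> m /msize_mdeg_lt /leq_trans; apply.
- exact: msupp_uniq.
rewrite big_mkcond /=; apply: eq_bigr => m _.
by case: ifPn => // /memN_msupp_eq0 ->; rewrite scale0r.
Qed.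

Lemma diffop_is_linear P : linear (diffop P).
Proof.
move=> c F G; rewrite /diffop scaler_sumr -big_split /=; apply: eq_bigr => m _.
by rewrite linearP scalerDr !scalerA mulrC.
Qed.

Lemma diffopDl c P Q : diffop (c *: P + Q) = c *: diffop P + diffop Q.
Proof.
apply/funext => F.
pose k := maxn (msize (c *: P + Q)) (maxn (msize P) (msize Q)).
rewrite /GRing.add /GRing.scale /=.
rewrite !(@diffopE _ _ k) ?leq_max ?leqnn ?orbT //.
rewrite scaler_sumr -big_split /=; apply: eq_bigr => m _.
by rewrite mcoeffD mcoeffZ scalerDl scalerA.
Qed.

Lemma diffop_homog d l P Q : Q \is d.-homog -> P \is l.-homog ->
  diffop Q P \is (l - d).-homog.
Proof.
move=> homQ homP; rewrite /diffop big_seq; apply: rpred_sum => m mQ.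
apply: rpredZ; apply/dhomogP => m'.
rewrite mcoeff_msupp mcoeff_mderivm => nz.
have mP : (m + m')%MM \in msupp P.
  by rewrite mcoeff_msupp; apply: contraNneq nz => ->; rewrite mul0rn.
have := dhomog_mf homP mP; rewrite /= mdegD (dhomog_mf homQ mQ) => <-.
by rewrite addKn.
Qed.

Lemma diffop_monomial l P m : P \is l.-homog -> mdeg m = l ->
  (diffop P 'X_[m])@_0 = P@_m *+ (\prod_(i < 2) (m i)`!).
Proof.
move=> homP degm; rewrite /diffop raddf_sum /=.
have E m' : (P@_m' *: ('X_[m] : bipoly R)^`M[m'])@_0 =
    if m' == m then P@_m *+ (\prod_(i < 2) (m i)`!) else 0.
  rewrite mcoeffZ mcoeff_mderivm addm0 mcoeffX [m == m']eq_sym.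
  case: eqP => [->|_]; last by rewrite mul0rn mulr0.
  rewrite mulrnAr mulr1; congr (_ *+ _); apply: eq_bigr => i _.
  by rewrite ffactnn.
rewrite (eq_bigr _ (fun m' _ => E m')).
have [mP|mP] := boolP (m \in msupp P).
  rewrite (bigD1_seq m) ?msupp_uniq //= eqxx [X in _ + X]big1 ?addr0 // => m'.
  by move=> /negbTE ->.
by rewrite (memN_msupp_eq0 mP) mul0rn big1 // => m' _; case: ifP.
Qed.

End DiffOp.

(* Homogeneous operators are a subspace of the space of all maps from
   polynomials to polynomials, so that their equality is equality of maps. *)
Definition is_hdiffop (R : realType) (l : nat) (D : bipoly R -> bipoly R) : bool :=
  `[< exists2 P : bipoly R, P \is l.-homog & D = diffop P >].

Record hdiffop (R : realType) (l : nat) := HDiffop {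
  hdiffop_fun :> bipoly R -> bipoly R;
  hdiffopP : hdiffop_fun \in (@is_hdiffop R l : {pred bipoly R -> bipoly R}) }.

Section HDiffop.
Variables (R : realType) (l : nat).

Lemma hdiffop_submod_closed :
  submod_closed (@is_hdiffop R l : {pred bipoly R -> bipoly R}).
Proof.
split.
  apply/asboolP; exists 0; first exact: rpred0.
  by apply/funext => F; rewrite /diffop msupp0 big_nil.
move=> c D E /asboolP[P homP ->] /asboolP[Q homQ ->].
apply/asboolP; exists (c *: P + Q); last by rewrite diffopDl.
by apply: rpredD => //; apply: rpredZ.
Qed.

HB.instance Definition _ :=
  GRing.isSubmodClosed.Build R[i] (bipoly R -> bipoly R) (@is_hdiffop R l)
    hdiffop_submod_closed.
HB.instance Definition _ := [isSub for @hdiffop_fun R l].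
HB.instance Definition _ := [Choice of hdiffop R l by <:].
HB.instance Definition _ := [SubChoice_isSubLmodule of hdiffop R l by <:].

Lemma hdiffop_fun_is_linear (D : hdiffop R l) : linear D.
Proof. by case: D => D /= /asboolP[P _ ->]; exact: diffop_is_linear. Qed.

HB.instance Definition _ (D : hdiffop R l) :=
  GRing.isLinear.Build R[i] (bipoly R) (bipoly R) _ (hdiffop_fun D)
    (hdiffop_fun_is_linear D).

Lemma of_hpoly_subproof (P : hpoly R l) :
  diffop P \in (@is_hdiffop R l : {pred bipoly R -> bipoly R}).
Proof. by apply/asboolP; exists (val P); [exact: dhomog_is_dhomog|]. Qed.

(* P(delta_0, delta_1) *)
Definition of_hpoly (P : hpoly R l) : hdiffop R l := HDiffop (of_hpoly_subproof P).

Lemma of_hpoly_is_linear : linear of_hpoly.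
Proof. by move=> c P Q; apply: val_inj; rewrite /= diffopDl. Qed.

HB.instance Definition _ :=
  GRing.isLinear.Build R[i] (hpoly R l) (hdiffop R l) _ of_hpoly of_hpoly_is_linear.

Lemma hdiffop_coef_inj (P Q : hpoly R l) :
  (forall F : hpoly R l, (of_hpoly P F)@_0 = (of_hpoly Q F)@_0) -> P = Q.
Proof.
move=> eqPQ; apply/val_inj/mpolyP => m.
have [degm|degm] := eqVneq (mdeg m) l; last first.
  rewrite (dhomog_nemf_coeff (dhomog_is_dhomog P) degm).
  by rewrite (dhomog_nemf_coeff (dhomog_is_dhomog Q) degm).
have homX : ('X_[m] : bipoly R) \is l.-homog by rewrite dhomogX; apply/eqP.
have := eqPQ (DHomog homX).
rewrite /= (diffop_monomial (dhomog_is_dhomog P) degm).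
rewrite (diffop_monomial (dhomog_is_dhomog Q) degm); apply: pmulrnI.
by rewrite prodn_gt0 // => i; rewrite fact_gt0.
Qed.

Lemma of_hpoly_bij : bijective of_hpoly.
Proof.
have surj (D : hdiffop R l) : exists P, of_hpoly P = D.
  have /asboolP[P homP eqD] := hdiffopP D.
  by exists (DHomog homP); apply: val_inj.
have [g gK] := choice surj; exists g => // P.
by apply: hdiffop_coef_inj => F; rewrite gK.
Qed.

Import VectorInternalTheory.

Lemma hdiffop_vecaxiom : Vector.axiom (dim (hpoly R l)) (hdiffop R l).
Proof.
have /cid[g [gK Kg]] : exists g, cancel of_hpoly g /\ cancel g of_hpoly.
  by case: of_hpoly_bij => g; exists g.
exists (fun D => v2r (g D)).
  move=> c D E; rewrite -linearP; congr (v2r _).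
  by apply: (can_inj gK); rewrite linearP /= !Kg.
exists (fun r => of_hpoly (r2v r)) => [D|r]; first by rewrite v2rK Kg.
by rewrite gK r2vK.
Qed.

HB.instance Definition _ :=
  Lmodule_hasFinDim.Build R[i] (hdiffop R l) hdiffop_vecaxiom.

(* D F is a constant polynomial, by hdiffop_const below. *)
Definition apply_const (D : hdiffop R l) (F : hpoly R l) : R[i]^o := (D F)@_0.

Lemma hdiffop_const (D : hdiffop R l) (F : hpoly R l) :
  D F = (apply_const D F)%:MP.
Proof.
have /asboolP[P homP eqD] := hdiffopP D.
have hom0 : D F \is 0.-homog.
  by have := diffop_homog homP (dhomog_is_dhomog F); rewrite subnn -eqD.
apply/mpolyP => m; rewrite mcoeffC.
have [->|nz] := eqVneq m 0%MM; first by rewrite mulr1.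
by rewrite mulr0 (dhomog_nemf_coeff hom0) //= mdeg_eq0.
Qed.

Lemma apply_const_is_linear (D : hdiffop R l) : linear (apply_const D).
Proof. by move=> c F G; rewrite /apply_const !linearP. Qed.

HB.instance Definition _ (D : hdiffop R l) :=
  GRing.isLinear.Build R[i] (hpoly R l) R[i]^o _ (apply_const D)
    (apply_const_is_linear D).

Definition eval_form (D : hdiffop R l) : dual (hpoly R l) := linfun (apply_const D).

Lemma eval_form_is_linear : linear eval_form.
Proof.
move=> c D E; apply/lfunP => F; rewrite !lfunE /= !lfunE /=.
by rewrite lfunE /apply_const /= mcoeffD mcoeffZ.
Qed.

HB.instance Definition _ :=
  GRing.isLinear.Build R[i] (hdiffop R l) (dual (hpoly R l)) _ eval_form
    eval_form_is_linear.

Definition D_ : 'Hom(hdiffop R l, dual (hpoly R l)) := linfun eval_form.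

Lemma D_E (D : hdiffop R l) (F : hpoly R l) : D_ D F = (D F)@_0.
Proof. by rewrite !lfunE. Qed.

Lemma D_ker : lker D_ == 0%VS.
Proof.
apply/lker0P => D E eqDE; have [g _ Kg] := of_hpoly_bij.
rewrite -(Kg D) -(Kg E); congr of_hpoly; apply: hdiffop_coef_inj => F.
by rewrite !Kg -!D_E eqDE.
Qed.

Lemma D_bij : bijective D_.
Proof.
have limgD : limg D_ = fullv.
  apply/eqP; rewrite eqEdim subvf limg_dim_eq ?(eqP D_ker) ?capv0 //.
  rewrite !dimvf dim_dual; exact: leqnn.
exists (D_^-1)%VF; first exact: lker0_lfunK D_ker.
by move=> phi; rewrite limg_lfunVK // limgD memvf.
Qed.

End HDiffop.

Arguments of_hpoly {R l} P.
Arguments D_ {R} l.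

Section Action.
Variables (R : realType) (d l : nat) (le_dl : (d <= l)%N).

(* Q(d/d delta_0, d/d delta_1) applied to P, with P read as a polynomial in the
   abstract variables delta_0, delta_1. *)
Definition hdiff (Q : hpoly R d) (P : hpoly R l) : hpoly R (l - d) :=
  DHomog (diffop_homog (dhomog_is_dhomog Q) (dhomog_is_dhomog P)).

Lemma hmul_subproof (Q : hpoly R d) (F : hpoly R (l - d)) :
  (Q : bipoly R) * F \is l.-homog.
Proof.
by have := dhomogM (dhomog_is_dhomog Q) (dhomog_is_dhomog F); rewrite subnKC.
Qed.

Definition hmul (Q : hpoly R d) (F : hpoly R (l - d)) : hpoly R l :=
  DHomog (hmul_subproof Q F).

Lemma hmul_is_linear (Q : hpoly R d) : linear (hmul Q).
Proof. by move=> c F G; apply: val_inj; rewrite /= mulrDr scalerAr. Qed.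

HB.instance Definition _ (Q : hpoly R d) :=
  GRing.isLinear.Build R[i] (hpoly R (l - d)) (hpoly R l) _ (hmul Q)
    (hmul_is_linear Q).

Definition m_ (Q : hpoly R d) : 'Hom(hpoly R (l - d), hpoly R l) :=
  linfun (hmul Q).

End Action.

(* Main.v *)
(* The pairing <P, F> = (P(delta) F)(0) is symmetric, since monomials are
   orthogonal for it, and P |-> P(delta) turns products into compositions. Hence
   <P, Q F> = <F Q, P> = <F, Q(delta) P> = <Q(delta) P, F>. *)

Require Import Defs.
From HB Require Import structures.
From mathcomp Require Import all_boot all_order all_algebra.
From mathcomp Require Import boolp functions reals.
From mathcomp Require Import complex.
From mathcomp Require Import ssrcomplements mpoly.

Set Implicit Arguments.
Unset Strict Implicit.
Unset Printing Implicit Defensive.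

Import GRing.Theory Num.Theory.

Local Open Scope ring_scope.

Lemma diffop0l (R : realType) (F : bipoly R) : diffop 0 F = 0.
Proof. by rewrite /diffop msupp0 big_nil. Qed.

Lemma diffopPl (R : realType) (c : R[i]) (P Q F : bipoly R) :
  diffop (c *: P + Q) F = c *: diffop P F + diffop Q F.
Proof. by rewrite diffopDl. Qed.

Lemma diffopX (R : realType) (m : 'X_{1..2}) (F : bipoly R) :
  diffop 'X_[m] F = F^`M[m].
Proof. by rewrite /diffop msuppX big_seq1 mcoeffX eqxx scale1r. Qed.

(** Both sides are bilinear in [P] and [Q], so monomials suffice; there it says that iterated
    partial derivatives compose by adding multi-orders. *)
Lemma diffopM (R : realType) (P Q F : bipoly R) :
  diffop (P * Q) F = diffop P (diffop Q F).
Proof.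
elim/mpolyind: P => [|c m P _ _ IHP]; first by rewrite mul0r !diffop0l.
rewrite mulrDl -scalerAl !diffopPl IHP diffopX; congr (c *: _ + _).
elim/mpolyind: Q {IHP} => [|e n Q _ _ IHQ].
  by rewrite mulr0 !diffop0l linear0.
(* [addmC] is needed because the derivative of order [n] is taken first. *)
by rewrite mulrDr -scalerAr !diffopPl linearP /= IHQ -mpolyXD !diffopX addmC
  mderivmDm.
Qed.

(** By bilinearity take monomials of exponents [m] and [n]: both constant terms vanish unless
    [m = n], and then the two sides coincide. *)
Lemma diffop_pairingC (R : realType) (P F : bipoly R) :
  (diffop P F)@_0 = (diffop F P)@_0.
Proof.
have lin (G : bipoly R) c H K :
    diffop G (c *: H + K) = c *: diffop G H + diffop G K.
  exact: diffop_is_linear.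
have diffop0r G : diffop G (0 : bipoly R) = 0.
  (* With scalar -1 and both arguments 0, the right side of linearity cancels. *)
  by have := lin G (-1) 0 0; rewrite scaler0 addr0 scaleN1r addNr.
elim/mpolyind: P => [|c m P _ _ IHP]; first by rewrite diffop0l diffop0r.
rewrite diffopPl lin !mcoeffD !mcoeffZ IHP; congr (c * _ + _).
elim/mpolyind: F {IHP} => [|e n F _ _ IHF]; first by rewrite diffop0l diffop0r.
rewrite diffopPl lin !mcoeffD !mcoeffZ IHF; congr (e * _ + _).
rewrite !diffopX !mcoeff_mderivm !addm0 !mcoeffX [n == m]eq_sym.
by case: eqP => [->|_]; rewrite ?mul0rn.
Qed.

Theorem theorem1p11 (R : realType) (d l : nat) (le_dl : (d <= l)%N)
    (P : hpoly R l) (Q : hpoly R d) :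
  transpose (m_ le_dl Q) (D_ l (of_hpoly P)) = D_ (l - d) (of_hpoly (hdiff Q P))
  /\ (D_ (l - d))^-1%VF (transpose (m_ le_dl Q) (D_ l (of_hpoly P)))
     = of_hpoly (hdiff Q P).
Proof.
have transposeE :
    transpose (m_ le_dl Q) (D_ l (of_hpoly P)) = D_ (l - d) (of_hpoly (hdiff Q P)).
  apply/lfunP => F; rewrite D_E comp_lfunE D_E /m_ lfunE /=.
  (* The order [F * Q] makes [Q] act on [P] first, leaving [F] to be moved back by symmetry. *)
  by rewrite diffop_pairingC mulrC diffopM diffop_pairingC.
(* The formal inverse cancels [D_] on the left because the kernel is trivial. *)
by split; rewrite transposeE // lker0_lfunK // D_ker.
Qed.
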